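(* Let $V$ be a Banach space densely and continuously embedded in a Banach space $E$, and let $P$ be a metric space. Suppose that for each $\mu\in P$ the family $\{A^{(\mu)}(t)\}_{t\geq0}$ of linear operators in $E$ satisfies (Hyp1)–(Hyp3) with constants $M,M_V\geq1$, $\omega,\omega_V$ independent of $\mu$. For $\mu\in P$, $\lambda>0$ let $A^{(\mu,\lambda)}(t):=A^{(\mu)}(t/\lambda)$ and let $\{R^{(\mu,\lambda)}(t,s)\}_{t\geq s\geq0}$ be the evolution system corresponding to $\{A^{(\mu,\lambda)}(t)\}_{t\geq0}$. Assume in addition that for each $\mu\in P$ there is a generator $\widehat A^{(\mu)}$ of a $C_0$ semigroup $\{\widehat S^{(\mu)}(t)\}_{t\geq0}$ on $E$ such that $V$ is $\widehat A^{(\mu)}$-admissible, $V\subset D(\widehat A^{(\mu)})$ and $\lim_{T\to+\infty,\ \nu\to\mu}\frac1T\int_0^T\|A^{(\nu)}(t+h)-\widehat A^{(\mu)}\|_{\mathcal L(V,E)}\,dt=0$ uniformly with respect to $h\geq0$. Then for any $\mu\in P$ and $\lambda>0$, $\|R^{(\mu,\lambda)}(t,s)\|\leq Me^{\omega(t-s)}$ whenever $0\leq s\leq t$, and for any $t\geq0$, $s\in[0,t]$, $\mu\in P$, $\bar u\in E$, $\lim_{\lambda\to0^+,\ \bar v\to\bar u,\ \nu\to\mu}R^{(\nu,\lambda)}(t,s)\bar v=\widehat S^{(\mu)}(t-s)\bar u$, uniformly for $t$ and $s$ from bounded intervals.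
   Context: For a generator $A$ of a $C_0$ semigroup $\{S_A(t)\}$ on $E$, $V$ is $A$-admissible if $V$ is invariant under every $S_A(t)$ and the restrictions $\{S_A(t)|_V\}_{t\geq0}$ form a $C_0$ semigroup on $V$; the part $A_V$ of $A$ in $V$ is $A_V\bar v=A\bar v$ on $D(A_V)=\{\bar v\in D(A)\cap V: A\bar v\in V\}$. The hyperbolic conditions for a family $\{A(t)\}_{t\geq0}$: (Hyp1) there are $M\geq1$, $\omega\in\mathbb{R}$ with $\|S_{A(t_n)}(s_n)\cdots S_{A(t_1)}(s_1)\|_{\mathcal L(E,E)}\leq Me^{\omega(s_1+\dots+s_n)}$ whenever $0\leq t_1\leq\dots\leq t_n$, $s_i\geq0$ (each $A(t)$ generating a $C_0$ semigroup $S_{A(t)}$); (Hyp2) $V$ is $A(t)$-admissible for each $t$ and $\{A_V(t)\}$ satisfies the analogous stability estimate on $V$ with constants $M_V\geq1$, $\omega_V$; (Hyp3) $V\subset D(A(t))$, $A(t)\in\mathcal L(V,E)$ for each $t$, and $t\mapsto A(t)\in\mathcal L(V,E)$ is continuous. The corresponding evolution system is the unique evolution system $\{R(t,s)\}$ on $E$ with $\|R(t,s)\|\leq Me^{\omega(t-s)}$, $\frac{\partial^+}{\partial t}R(t,s)v|_{t=s}=A(s)v$ and $\frac{\partial}{\partial s}R(t,s)v=-R(t,s)A(s)v$ for $v\in V$, $0\leq s\leq t$. $\|\widehat A^{(\mu)}\cdots\|_{\mathcal L(V,E)}$ refers to operator norms of restrictions to $V$. *)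

(* Defs.v *)
From HB Require Import structures.
From mathcomp Require Import all_boot all_order all_algebra.
From mathcomp Require Import all_classical all_reals all_analysis.
Set Implicit Arguments. Unset Strict Implicit. Unset Printing Implicit Defensive.
Import Order.TTheory GRing.Theory Num.Theory.
Import numFieldNormedType.Exports.
Local Open Scope classical_set_scope.
Local Open Scope ring_scope.

Section defs.
Context {R : realType}.

Definition C0_semigroup (X : normedModType R) (S : R -> X -> X) : Prop :=
  [/\ (forall t, 0 <= t -> linear (S t) /\ continuous (S t)),
      (forall x, S 0 x = x),
      (forall t s x, 0 <= t -> 0 <= s -> S (t + s) x = S t (S s x)) &
      (forall x, S t x @[t --> 0^'+] --> x)].

Definition generates (X : normedModType R) (D : set X) (A : X -> X)
    (S : R -> X -> X) : Prop :=
  [/\ C0_semigroup S,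
      (forall x, D x <-> exists y : X, h^-1 *: (S h x - x) @[h --> 0^'+] --> y) &
      (forall x, D x -> h^-1 *: (S h x - x) @[h --> 0^'+] --> A x)].

(** V (embedded in E by j) is A-admissible, where A generates S on E:
    V is S(t)-invariant and the restrictions SV form a C_0 semigroup on V. *)
Definition admissible (V E : normedModType R) (j : V -> E)
    (S : R -> E -> E) (SV : R -> V -> V) : Prop :=
  (forall t v, 0 <= t -> j (SV t v) = S t (j v)) /\ C0_semigroup SV.

Definition part_in (V E : normedModType R) (j : V -> E) (D : set E) (A : E -> E)
    (DV : set V) (AV : V -> V) : Prop :=
  (forall v, DV v <-> (D (j v) /\ exists w, j w = A (j v))) /\
  (forall v, DV v -> j (AV v) = A (j v)).

Fixpoint prodS (X : Type) (S : R -> R -> X -> X) (ts ss : nat -> R) (n : nat)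
    (x : X) : X :=
  match n with
  | 0%N => x
  | m.+1 => S (ts m) (ss m) (prodS S ts ss m x)
  end.

Definition stable (X : normedModType R) (S : R -> R -> X -> X) (M w : R) : Prop :=
  forall (n : nat) (ts ss : nat -> R),
    0 <= ts 0%N ->
    (forall i, (i.+1 < n)%N -> ts i <= ts i.+1) ->
    (forall i, (i < n)%N -> 0 <= ss i) ->
    forall x, `|prodS S ts ss n x| <= M * expR (w * \sum_(i < n) ss i) * `|x|.

Definition opnorm (V E : normedModType R) (f : V -> E) : \bar R :=
  ereal_sup [set (`|f x|)%:E | x in [set x : V | `|x| <= 1]].

Definition evolution_system (E : normedModType R) (Rts : R -> R -> E -> E) : Prop :=
  [/\ (forall t s, 0 <= s <= t -> linear (Rts t s) /\ continuous (Rts t s)),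
      (forall s x, 0 <= s -> Rts s s x = x),
      (forall t r s x, 0 <= s -> s <= r -> r <= t -> Rts t r (Rts r s x) = Rts t s x) &
      (forall x, {within [set p : R * R | 0 <= p.2 <= p.1],
                   continuous (fun p => Rts p.1 p.2 x)})].

Definition corresponding_evol (V E : normedModType R) (j : V -> E)
    (A : R -> E -> E) (M w : R) (Rts : R -> R -> E -> E) : Prop :=
  [/\ evolution_system Rts,
      (forall t s x, 0 <= s <= t -> `|Rts t s x| <= M * expR (w * (t - s)) * `|x|),
      (forall s v, 0 <= s ->
         h^-1 *: (Rts (s + h) s (j v) - j v) @[h --> 0^'+] --> A s (j v)) &
      (forall t s v, 0 <= s <= t ->
         h^-1 *: (Rts t (s + h) (j v) - Rts t s (j v))
           @[h --> within [set h | h != 0 /\ 0 <= s + h <= t] (nbhs 0)]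
           --> - Rts t s (A s (j v)))].

End defs.

(* Main.v *)
(* For v in V, the path r |-> R(t,r) S^(r-s) v joins R(t,s) v to S^(t-s) v, and its
   derivative is R(t,r) (A^ - A(r/lambda)) S^(r-s) v, where r |-> S^(r-s) v is
   bounded in V. Hence the distance between the two endpoints is at most a constant
   times the integral over [s,t] of ||A(r/lambda) - A^||_{L(V,E)}, which in the fast
   time T = (t-s)/lambda is lambda times an integral over [0,T] controlled by the
   averaging hypothesis. Since the integrand is nonnegative, integrating over
   [0,T+T1] instead of [0,T] bounds it by e (T+T1) for every T >= 0, so that short
   intervals need no separate treatment. Density of V and equiboundedness of the
   evolution systems extend the convergence to E. *)
Require Import Defs.
From HB Require Import structures.
From mathcomp Require Import all_boot all_order all_algebra.
From mathcomp Require Import all_classical all_reals all_analysis.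
From mathcomp Require Import ring lra.
Set Implicit Arguments. Unset Strict Implicit. Unset Printing Implicit Defensive.
Import Order.TTheory GRing.Theory Num.Theory.
Import numFieldNormedType.Exports.
Local Open Scope classical_set_scope.
Local Open Scope ring_scope.

(** * A mean value inequality for right derivatives *)

Lemma near_right0 (R : realType) (Q : R -> Prop) :
  (\forall h \near 0^'+, Q h) <->
  exists2 d : R, 0 < d & forall h, 0 < h -> h < d -> Q h.
Proof.
split=> [[d /= d0 dQ]|[d d0 dQ]].
  exists d => // h h0 hd; apply: (dQ h) => //=.
  by rewrite /ball_/= distrC subr0 gtr0_norm.
exists d => //= h; rewrite /ball_/= distrC subr0 => /[swap] h0.
rewrite gtr0_norm// => hd; exact: dQ.
Qed.

(** A semigroup orbit gives a right derivative only, and a vector-valued path has no mean value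
    equality. A slack [e] per unit length, sent to 0 at the end, makes a continuation argument from
    [a] to [b] possible. *)
Lemma mean_value_ineq_right (R : realType) (E : normedModType R)
    (phi dphi : R -> E) (F f : R -> R) (a b : R) :
  a <= b -> {within `[a, b], continuous phi} ->
  (forall c, a <= c <= b -> is_derive c 1 F (f c)) ->
  (forall c, a <= c < b -> h^-1 *: (phi (c + h) - phi c) @[h --> 0^'+] --> dphi c) ->
  (forall c, a <= c < b -> `|dphi c| <= f c) ->
  `|phi b - phi a| <= F b - F a.
Proof.
move=> ab cphi dF dph fph.
have cF c : a <= c <= b -> {for c, continuous F}.
  by move=> /dF dFc; apply/differentiable_continuous/derivable1_diffP.
rewrite -subr_le0; apply/ler_addgt0Pl => eps eps0; rewrite addr0.
have ab1 : 0 < b - a + 1 by rewrite ltr_wpDl// subr_ge0.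
(* The [+ 1] covers [a = b]; all that matters is [0 < e] and [e * (b - a) <= eps]. *)
pose e := eps / (b - a + 1).
have e0 : 0 < e by rewrite divr_gt0.
(* The largest [c] with [psi c <= psi a] is [b]: the set of such points is closed
   by continuity and, below [b], can be extended to the right. *)
pose psi r := `|phi r - phi a| - F r - e * r.
pose Z := [set r | a <= r <= b /\ psi r <= psi a].
have Za : Z a by split; rewrite // lexx ab.
have Zub : ubound Z b by move=> r [/andP[]].
have Zsup : has_sup Z by split; [exists a|exists b].
set c := sup Z.
have ac : a <= c by apply: ub_le_sup => //; exists b.
have cb : c <= b by apply: ge_sup => //; exists a.
have Zc : psi c <= psi a.
  (* The strict inequality would persist on a neighbourhood of [c] in [[a, b]], which meets [Z]
     because [c] is adherent to it. *)
  rewrite leNgt; apply/negP => pc.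
  have cc : closure Z c by apply: closure_sup => //; [exists a|exists b].
  have psic : psi r @[r --> within `[a, b]%classic (nbhs c)] --> psi c.
    have wF : F r @[r --> within `[a, b]%classic (nbhs c)] --> F c.
      by apply: cvg_within_filter; apply: cF; rewrite ac cb.
    have wphi : phi r @[r --> within `[a, b]%classic (nbhs c)] --> phi c.
      by move/subspace_continuousP : cphi; apply; rewrite /= in_itv/= ac cb.
    apply: cvgB; first apply: cvgB => //.
      by apply: cvg_norm; apply: cvgB => //; exact: cvg_cst.
    apply: cvgM; first exact: cvg_cst.
    by apply: cvg_within_filter; exact: cvg_id.
  have /(psic _) : nbhs (psi c) [set y | psi a < y] by apply: open_nbhs_nbhs; split=> //; exact: open_gt.
  rewrite nbhs_simpl /= /within /= => /cc [r [[/andP[ar rb] par]]] /=.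
  by rewrite in_itv/= ar rb => /(_ isT); rewrite ltNge par.
have [cbE|/negP cnb] := boolP (c == b).
  have bE := eqP cbE; move: Zc; rewrite bE /psi subrr normr0 sub0r.
  have : e * (b - a) <= eps.
    rewrite /e mulrAC ler_pdivrMr// ler_pM2l//; lra.
  by rewrite mulrBr => h1 h2; lra.
have cb' : c < b by rewrite lt_neqAle cb andbT; apply/negP.
have acb : a <= c < b by rewrite ac cb'.
have e20 : 0 < e / 2 by rewrite divr_gt0.
(* The slack [e * h] is split evenly between the increment of [phi] and that of [F]; together they
   give [psi (c + h) <= psi c], so that [c + h] lies in [Z]. *)
have /near_right0[d1 d10 d1P] : \forall h \near 0^'+,
    `|phi (c + h) - phi c| <= h * (f c + e / 2).
  have /cvgrPdist_lt/(_ _ e20) := dph c acb.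
  move=> /near_right0[d d0 dP]; apply/near_right0; exists d => // h h0 hd.
  have := dP h h0 hd; have := fph c acb.
  set q := h^-1 *: _ => fc hq.
  have -> : phi (c + h) - phi c = h *: q by rewrite /q scalerA divff ?gt_eqF// scale1r.
  rewrite normrZ gtr0_norm// ler_pM2l//.
  rewrite -[q](addrNK (dphi c)) (le_trans (ler_normD _ _))//.
  by rewrite addrC lerD// distrC ltW.
have /near_right0[d2 d20 d2P] : \forall h \near 0^'+,
    h * (f c - e / 2) <= F (c + h) - F c.
  have dFc : is_derive c 1 F (f c) by apply: dF; rewrite ac cb.
  have : h^-1 *: (F (h *: 1 + c) - F c) @[h --> 0^'] --> f c.
    by case: dFc => dv <-; exact: dv.
  move=> /cvg_dnbhs_at_right/cvgrPdist_lt/(_ _ e20).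
  move=> /near_right0[d d0 dP]; apply/near_right0; exists d => // h h0 hd.
  have := dP h h0 hd; rewrite scaler1 (addrC h) => /ltr_distlBl => hq.
  by rewrite -ler_pdivlMl// ltW.
pose h := Num.min (Num.min d1 d2) (b - c) / 2.
have m0 : 0 < Num.min (Num.min d1 d2) (b - c) by rewrite !lt_min d10 d20 subr_gt0.
have h0 : 0 < h by rewrite divr_gt0.
have : h < Num.min (Num.min d1 d2) (b - c) by rewrite /h ltr_pdivrMr// mulr_natr mulr2n ltrDl.
rewrite !lt_min => /andP[/andP[hd1 hd2] hbc].
have : c + h <= c.
  apply: ub_le_sup; first by exists b.
  split=> /=; first by apply/andP; split; lra.
  apply: le_trans Zc; rewrite /psi.
  have := d1P h h0 hd1; have := d2P h h0 hd2.
  have : `|phi (c + h) - phi a| <= `|phi (c + h) - phi c| + `|phi c - phi a|.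
    by rewrite -[X in `|X| <= _](subrKA (phi c)) ler_normD.
  move: h0 => _; rewrite !(mulrDr, mulrBr); lra.
by rewrite gerDl leNgt h0.
Qed.

(** * Linear maps and their operator norms *)

Section linear_maps.
Context {R : realType} {V E : normedModType R}.
Implicit Types f : V -> E.

Let pack f (lf : linear f) : {linear V -> E} :=
  HB.pack f (GRing.isLinear.Build _ _ _ _ _ lf).

Lemma linear_fun0 f : linear f -> f 0 = 0.
Proof. by move=> lf; move: (linear0 (pack lf)) => /=. Qed.

Lemma linear_funB f : linear f -> {morph f : x y / x - y}.
Proof. by move=> lf; move: (linearB (pack lf)) => /=. Qed.

Lemma linear_funZ f : linear f -> forall a, {morph f : x / a *: x}.
Proof. by move=> lf; move: (linearZ_LR (pack lf)) => /=. Qed.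

Lemma linear_subfun f g : linear f -> linear g -> linear (fun v => f v - g v).
Proof. by move=> lf lg a x y; rewrite lf lg opprD addrACA scalerBr. Qed.

Lemma linear_continuous_norm_le f : linear f -> continuous f ->
  exists2 k, 0 <= k & forall v, `|f v| <= k * `|v|.
Proof.
move=> lf /(_ 0)/(@continuous_linear_bounded _ _ _ 0 (pack lf)).
move=> /(linear_boundedP (pack lf)) /pinfty_ex_gt0[k k0 kP].
by exists k => //; exact: ltW.
Qed.

Lemma linear_norm_le f k : linear f -> (forall v, `|v| <= 1 -> `|f v| <= k) ->
  forall v, `|f v| <= k * `|v|.
Proof.
move=> lf fk v; have [->|v0] := eqVneq v 0.
  by rewrite linear_fun0// !normr0 mulr0.
have nv0 : 0 < `|v| by rewrite normr_gt0.
rewrite mulrC -ler_pdivrMl// -[X in X * _](@gtr0_norm _ `|v|^-1) ?invr_gt0//.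
rewrite -normrZ -linear_funZ//; apply: fk.
by rewrite normrZ normfV normr_id mulVf// normr_eq0.
Qed.

Lemma opnorm_ge0 f : (0 <= opnorm f)%E.
Proof.
apply: (@le_trans _ _ (`|f 0|)%:E); first by rewrite lee_fin.
by apply: ereal_sup_ubound; exists 0 => //=; rewrite normr0.
Qed.

Lemma opnorm_le f k : (forall v, `|f v| <= k * `|v|) -> 0 <= k ->
  (opnorm f <= k%:E)%E.
Proof.
move=> fk k0; apply: ge_ereal_sup => _ [v /= v1 <-]; rewrite lee_fin.
by rewrite (le_trans (fk v))// ler_piMr.
Qed.

Lemma le_opnorm f k : linear f -> (opnorm f <= k%:E)%E ->
  forall v, `|f v| <= k * `|v|.
Proof.
move=> lf fk; apply: linear_norm_le => // v v1; rewrite -lee_fin.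
by apply: le_trans fk; apply: ereal_sup_ubound; exists v.
Qed.

Lemma opnorm_fin_num f k : (forall v, `|f v| <= k * `|v|) -> 0 <= k ->
  opnorm f \is a fin_num.
Proof.
by move=> fk k0; rewrite ge0_fin_numE ?opnorm_ge0// (le_lt_trans (opnorm_le fk k0))// ltry.
Qed.

(** Reverse triangle inequality: each norm is at most [k] plus the other. *)
Lemma fine_opnorm_dist f g k : linear f -> linear g ->
  opnorm f \is a fin_num -> opnorm g \is a fin_num ->
  (opnorm (fun v => f v - g v)%R <= k%:E)%E ->
  `|fine (opnorm f) - fine (opnorm g)| <= k.
Proof.
move=> lf lg ff gf fgk.
have k0 : 0 <= k by rewrite -lee_fin (le_trans (opnorm_ge0 _) fgk).
have aux f1 g1 : linear g1 -> opnorm f1 \is a fin_num -> opnorm g1 \is a fin_num ->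
    (forall v, `|f1 v - g1 v| <= k * `|v|) -> fine (opnorm f1) <= k + fine (opnorm g1).
  move=> lg1 ff1 gf1 fg; rewrite -lee_fin fineK//; apply: opnorm_le.
    move=> v; rewrite -[f1 v](subrK (g1 v)) (le_trans (ler_normD _ _))// mulrDl.
    by rewrite lerD// le_opnorm// fineK.
  by rewrite addr_ge0// fine_ge0// opnorm_ge0.
have fg := le_opnorm (linear_subfun lf lg) fgk.
rewrite ler_distlC lerBlDl aux//= addrC aux// => v.
by rewrite distrC.
Qed.

End linear_maps.

(** * Generators, local bounds and strong continuity of semigroups *)

Section C0_semigroups.
Context {R : realType}.

(** In [generates] the operator is a bare function; it inherits linearity from the difference
    quotients by uniqueness of limits. *)
Lemma generator_linear (V E : normedModType R) (j : V -> E) D A S :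
  generates D A S -> linear j -> (forall v, D (j v)) -> linear (fun v => A (j v)).
Proof.
move=> [[linS _ _ _] _ dS] linj Dj a x y.
apply: (cvg_unique (@norm_hausdorff _ E) (dS _ (Dj (a *: x + y)))).
rewrite /=; pose q v h := h^-1 *: (S h (j v) - j v).
have : (a \*: q x + q y) h @[h --> 0^'+] --> a *: A (j x) + A (j y).
  by apply: cvgD; [apply: cvgZl_tmp|]; exact: dS.
apply: cvg_trans; apply: near_eq_cvg; near=> h.
have h0 : 0 <= h by near: h; exact: nbhs_right_ge.
have [lS _] := linS h h0.
rewrite linj lS/= /q.
rewrite -[LHS]/(a *: (h^-1 *: _) + _) scalerA mulrC -scalerA -scalerDr.
by congr (_ *: _); rewrite scalerBr opprD addrACA.
Unshelve. all: by end_near. Qed.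

(* If the bound failed on every [0, 1/n], times u_n -> 0 with |S(u_n)| > n would
   contradict the uniform boundedness principle, as S(u_n) x -> x for each x. *)
Lemma C0_semigroup_bounded_near0 (X : completeNormedModType R) S :
  @C0_semigroup R X S -> exists2 d : R, 0 < d & exists2 K : R, 1 <= K &
  forall t x, 0 <= t <= d -> `|S t x| <= K * `|x|.
Proof.
move=> [linS S0 SD cS]; apply: contrapT => nb.
have /choice[u uP] (n : nat) : exists t, (0 <= t <= n.+1%:R^-1) /\
    ~ (forall x, `|S t x| <= n.+1%:R * `|x|).
  apply: contrapT => nt; apply: nb; exists n.+1%:R^-1 => //.
  exists n.+1%:R; first by rewrite ler1n.
  move=> t x td; apply: contrapT => tx; apply: nt; exists t; split => //.
have u_ge0 n : 0 <= u n by have [/andP[]] := uP n.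
have linSu n : linear (S (u n)) by have [] := linS _ (u_ge0 n).
have : uniform_bounded (range (fun n => S (u n))).
  apply: Banach_Steinhauss => [_ [n _ <-]|x].
    have [lS ctS] := linS _ (u_ge0 n); split => //.
    have [k k0 kP] := linear_continuous_norm_le lS ctS.
    move=> r; exists (k * r) => y yr; apply: (le_trans (kP y)).
    by rewrite ler_wpM2l.
  have /cvg_seq_bounded : cvgn (fun n => S (u n) x).
    apply/cvg_ex; exists x; apply/cvgrPdist_lt => e e0.
    have /cvgrPdist_lt/(_ _ e0)/near_right0[d d0 dP] := cS x.
    (* The limit along [0^'+] says nothing at 0 itself, where [S0] is used instead. *)
    near=> n; have [un0|un0] := eqVneq (u n) 0.
      by rewrite un0 S0 subrr normr0.
    apply: dP; first by rewrite lt_neqAle eq_sym un0 u_ge0.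
    have [/andP[_ un] _] := uP n; apply: le_lt_trans un _.
    by near: n; exact: near_infty_natSinv_lt (PosNum d0).
  move=> /pinfty_ex_gt0[B B0 BP]; exists B => _ [n _ <-].
  exact: BP.
move=> /(_ 1)[B BP].
(* At this index the refuted bound is [(Num.truncn B).+1], which exceeds [B]. *)
have [_] := uP (Num.truncn B); apply.
apply: linear_norm_le => // v v1.
rewrite (@le_trans _ _ B)//; first by apply: BP => //; exists (Num.truncn B).
by apply: ltW; exact: truncnS_gt.
Unshelve. all: by end_near. Qed.

(** The bound near 0 is iterated in steps of length [d]. As [1 <= K], the power [K ^+ n.+1] covers
    all of [[0, n * d]], including [n = 0]. *)
Lemma C0_semigroup_locally_bounded (X : completeNormedModType R) S :
  @C0_semigroup R X S -> forall T : R, exists2 K, 0 < K &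
  forall t x, 0 <= t <= T -> `|S t x| <= K * `|x|.
Proof.
move=> C0S; have [_ _ SD _] := C0S.
have [d d0 [K K1 KP]] := C0_semigroup_bounded_near0 C0S.
have Kn n t x : 0 <= t <= n%:R * d -> `|S t x| <= K ^+ n.+1 * `|x|.
  elim: n t x => [|n IHn] t x.
    rewrite mul0r => /andP[t0 t1]; rewrite expr1 KP// t0 (le_trans t1)//.
    exact: ltW.
  rewrite -natr1 mulrDl mul1r => /andP[t0 tn]; have [td|dt] := leP t d.
    apply: (le_trans (KP t x _)); first by rewrite t0.
    by rewrite ler_wpM2r// ler_eXnr.
  rewrite -(subrK d t) addrC SD ?subr_ge0 ?(ltW dt) ?(ltW d0)//.
  apply: (le_trans (KP d _ _)); first by rewrite lexx ltW.
  rewrite exprS -mulrA ler_wpM2l ?(le_trans ler01)//.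
  by apply: IHn; rewrite subr_ge0 (ltW dt) lerBlDr.
move=> T; exists (K ^+ (Num.truncn (T / d)).+2); first by rewrite exprn_gt0// (lt_le_trans ltr01).
move=> t x /andP[t0 tT]; apply: Kn; rewrite t0 (le_trans tT)//.
by rewrite -ler_pdivrMr// ltW// truncnS_gt.
Qed.

(** For [a < b], [S a x - S b x = S a (x - S (b - a) x)]: the local bound reduces continuity from
    either side to right continuity at 0. *)
Lemma C0_semigroup_continuous (X : completeNormedModType R) S (x : X) :
  C0_semigroup S -> {within `[0, +oo[, continuous (fun t : R => S t x)}.
Proof.
move=> C0S; apply/subspace_continuousP => c /=; rewrite in_itv/= andbT => c0.
have [linS S0 SD cS] := C0S.
have [K K0 KP] := C0_semigroup_locally_bounded C0S (c + 1).
apply/cvgrPdist_lt => e e0; have eK : 0 < e / K by rewrite divr_gt0.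
have /cvgrPdist_lt/(_ _ eK)/near_right0[d d0 dP] := cS x.
have dS a b : 0 <= a -> a < b -> b - a < d -> b <= c + 1 -> `|S a x - S b x| < e.
  move=> a0 ab bad bc; rewrite -[b](subrK a) (addrC _ a) SD ?subr_ge0 ?(ltW ab)//.
  have [lS _] := linS a a0; rewrite -(linear_funB lS).
  apply: (le_lt_trans (KP _ _ _)); first by rewrite a0 (le_trans (ltW ab)).
  by rewrite mulrC -ltr_pdivlMr// dP// subr_gt0.
rewrite near_withinE; near=> r => /=; rewrite in_itv/= andbT => r0.
have rc1 : r <= c + 1 by apply: ltW; near: r; apply: lt_nbhsl; rewrite ltrDl.
have : `|c - r| < d by near: r; exact: cvgr_dist_lt.
rewrite ltr_distlC => /andP[rd1 rd2].
have [cr|rc|<-] := ltgtP c r; last by rewrite subrr normr0.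
  by apply: dS => //; lra.
by rewrite distrC; apply: dS => //; lra.
Unshelve. all: by end_near. Qed.

End C0_semigroups.

(** * Comparison of an evolution system with a semigroup *)

(** Strong continuity concerns a fixed vector; equiboundedness lets the vector move along with the
    operator, since [B r (x r) - B r l] has norm at most [C * |x r - l|]. *)
Lemma cvg_equibounded_apply (R : realType) (X Y : normedModType R) (T : Type)
    (G : set_system T) (B : T -> X -> Y) (x : T -> X) (l : X) (m : Y) (C : R) :
  Filter G ->
  (\forall r \near G, linear (B r) /\ forall y, `|B r y| <= C * `|y|) ->
  x @ G --> l -> B r l @[r --> G] --> m -> B r (x r) @[r --> G] --> m.
Proof.
move=> FG GB xl Bl.
suff B0 : B r (x r) - B r l @[r --> G] --> (0 : Y).
  have : (B r (x r) - B r l) + B r l @[r --> G] --> 0 + m by exact: cvgD.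
  rewrite add0r; apply: cvg_trans; apply: near_eq_cvg.
  by near=> r; rewrite /= subrK.
apply/cvgrPdist_lt => e e0; near=> r; rewrite sub0r normrN.
have [lB BC] : linear (B r) /\ forall y, `|B r y| <= C * `|y| by near: r.
rewrite -(linear_funB lB).
have C1 : 0 < `|C| + 1 by rewrite ltr_wpDl.
apply: (le_lt_trans (BC _)); apply: (@le_lt_trans _ _ ((`|C| + 1) * `|x r - l|)).
  by rewrite ler_wpM2r// (le_trans (ler_norm _))// lerDl.
rewrite mulrC -ltr_pdivlMr// distrC; near: r.
by apply: cvgr_dist_lt => //; rewrite divr_gt0.
Unshelve. all: by end_near. Qed.

Lemma evolution_system_cvg_at (R : realType) (E : normedModType R)
    (Rts : R -> R -> E -> E) s t c x :
  evolution_system Rts -> 0 <= s -> s <= c <= t ->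
  Rts t r x @[r --> within `[s, t]%classic (nbhs c)] --> Rts t c x.
Proof.
move=> [_ _ _ /(_ x) /subspace_continuousP cR] s0 /andP[sc ct].
have {}cR := cR (t, c); apply: cvg_trans; last first.
  by apply: cR => /=; rewrite ct (le_trans s0).
move=> U [[/= U1 U2] /= [nU1 nU2] UU].
suff : \forall r \near within `[s, t]%classic (nbhs c), U (Rts t r x) by [].
rewrite near_withinE; near=> r => /=; rewrite in_itv/= => /andP[sr rt].
apply: (UU (t, r)) => /=; last by rewrite rt (le_trans s0).
by split => /=; [exact: nbhs_singleton|near: r].
Unshelve. all: by end_near. Qed.

(* The right derivative of [r |-> Rts t r (j (SVh (r - s) v))] is
   [Rts t r ((Ah - A r) (j (SVh (r - s) v)))]. *)
Lemma evol_semigroup_dist (R : realType) (V E : normedModType R) (j : V -> E)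
    (A : R -> E -> E) (M w : R) (Rts : R -> R -> E -> E)
    (Dh : set E) (Ah : E -> E) (Sh : R -> E -> E) (SVh : R -> V -> V)
    (F f : R -> R) (C K s t : R) (v : V) :
  linear j -> continuous j -> corresponding_evol j A M w Rts ->
  generates Dh Ah Sh -> admissible j Sh SVh -> (forall z, Dh (j z)) ->
  {within `[0, +oo[, continuous (fun r => SVh r v)} ->
  0 <= s <= t -> 0 <= C ->
  (forall r x, s <= r <= t -> `|Rts t r x| <= C * `|x|) ->
  (forall r, 0 <= r <= t - s -> `|SVh r v| <= K) ->
  (forall r, s <= r <= t -> is_derive r 1 F (f r)) ->
  (forall r, s <= r <= t -> 0 <= f r) ->
  (forall r z, s <= r <= t -> `|A r (j z) - Ah (j z)| <= f r * `|z|) ->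
  `|Sh (t - s) (j v) - Rts t s (j v)| <= C * K * (F t - F s).
Proof.
move=> linj contj [evolR _ _ dR] [_ _ dSh] [jS C0SV] Dhj cSV /andP[s0 st] C0 RC SK
  dF f0 Af.
have [linR R1 _ _] := evolR.
have [_ SV0 SVD _] := C0SV.
have t0 := le_trans s0 st.
pose y r := SVh (r - s) v.
pose phi r := Rts t r (j (y r)).
have -> : Sh (t - s) (j v) = phi t by rewrite /phi R1// -jS// subr_ge0.
have -> : Rts t s (j v) = phi s by rewrite /phi /y subrr SV0.
rewrite mulrBr.
apply: (@mean_value_ineq_right _ _ phi
  (fun r => Rts t r (Ah (j (y r)) - A r (j (y r))))
  (fun r => C * K * F r) (fun r => C * K * f r)) => //.
- apply/subspace_continuousP => c /=; rewrite in_itv/= => /andP[sc ct].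
  apply: (@cvg_equibounded_apply _ _ _ _ _ _ _ (j (y c)) _ C).
  + rewrite near_withinE; near=> r => /=; rewrite in_itv/= => /andP[sr rt].
    split; last by move=> z; apply: RC; rewrite sr rt.
    by have [] := linR t r; rewrite // rt (le_trans s0).
  + apply: continuous_cvg; first exact: contj.
    have /subspace_continuousP/(_ (c - s)) := cSV.
    rewrite /= in_itv/= andbT subr_ge0 => /(_ sc); apply: cvg_trans.
    move=> U.
    suff : (\forall r \near within `[0, +oo[%classic (nbhs (c - s)), U (SVh r v)) ->
        \forall r \near within `[s, t]%classic (nbhs c), U (SVh (r - s) v) by [].
    rewrite !near_withinE => UU.
    have : (r - s) @[r --> c] --> c - s by apply: cvgB; [exact: cvg_id|exact: cvg_cst].
    move=> /(_ _ UU) UU'; near=> r => /=; rewrite in_itv/= => /andP[sr _].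
    have : `[0, +oo[%classic (r - s) by rewrite /= in_itv/= andbT subr_ge0.
    by near: r.
  + by apply: evolution_system_cvg_at => //; rewrite sc.
- move=> c /dF dFc.
  exact: is_deriveZ.
- move=> c /andP[sc ct].
  have c0 : 0 <= c by exact: le_trans sc.
  have ct' := ltW ct.
  have near_ct : \forall h \near 0^'+, s <= c + h <= t.
    near=> h; apply/andP; split.
      by rewrite (le_trans sc)// lerDl; near: h; exact: nbhs_right_ge.
    rewrite addrC -lerBrDr; apply: ltW; near: h; apply: nbhs_right_lt.
    by rewrite subr_gt0.
  have Rct : linear (Rts t c) by have [] := linR t c; rewrite // c0 ct'.
  rewrite (linear_funB Rct).
  (* Product rule: the increment of [phi] is [Rts t (c + h)] applied to the increment of the orbit
     ([quot1]), plus the increment of [Rts t] at the fixed vector [j (y c)] ([quot2]). *)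
  have quot1 : Rts t (c + h) (h^-1 *: (Sh h (j (y c)) - j (y c))) @[h --> 0^'+] -->
      Rts t c (Ah (j (y c))).
    apply: (@cvg_equibounded_apply _ _ _ _ _ (fun h => Rts t (c + h)) _ (Ah (j (y c))) _ C).
    + near=> h; have /andP[sr rt] : s <= c + h <= t by near: h.
      split; last by move=> z; apply: RC; rewrite sr rt.
      by have [] := linR t (c + h); rewrite // rt (le_trans s0).
    + exact: dSh.
    + have : s <= c <= t by rewrite sc.
      move=> /(evolution_system_cvg_at (x := Ah (j (y c))) evolR s0); apply: cvg_trans => U.
      suff : (\forall r \near within `[s, t]%classic (nbhs c), U (Rts t r (Ah (j (y c))))) ->
          \forall h \near 0^'+, U (Rts t (c + h) (Ah (j (y c)))) by [].
      rewrite near_withinE => UU.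
      have : c + h @[h --> 0^'+] --> c.
        rewrite -[X in _ --> X]addr0; apply: cvgD; first exact: cvg_cst.
        by apply: cvg_within_filter; exact: cvg_id.
      move=> /(_ _ UU) => UU'; near=> h.
      have : `[s, t]%classic (c + h) by rewrite /= in_itv/=; near: h.
      by near: h.
  have quot2 : h^-1 *: (Rts t (c + h) (j (y c)) - Rts t c (j (y c))) @[h --> 0^'+] -->
      - Rts t c (A c (j (y c))).
    have : 0 <= c <= t by rewrite c0.
    move=> /(dR t c (y c)); apply: cvg_trans => U.
    set q := (fun h => _).
    suff : (\forall h \near within [set h | h != 0 /\ 0 <= c + h <= t] (nbhs 0), U (q h)) ->
        \forall h \near 0^'+, U (q h) by [].
    rewrite near_withinE => UU; near=> h.
    have h0 : 0 < h by near: h; exact: nbhs_right_gt.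
    have /andP[sr rt] : s <= c + h <= t by near: h.
    have : [set h | h != 0 /\ 0 <= c + h <= t] h.
      by rewrite /= gt_eqF// rt (le_trans s0).
    by near: h; apply: (@cvg_within _ (nbhs (0 : R))).
  have : Rts t (c + h) (h^-1 *: (Sh h (j (y c)) - j (y c))) +
      h^-1 *: (Rts t (c + h) (j (y c)) - Rts t c (j (y c))) @[h --> 0^'+] -->
      Rts t c (Ah (j (y c))) - Rts t c (A c (j (y c))) by exact: cvgD.
  apply: cvg_trans; apply: near_eq_cvg.
  near=> h => /=.
  have /andP[sr rt] : s <= c + h <= t by near: h.
  have Rch : linear (Rts t (c + h)).
    by have [] := linR t (c + h); rewrite // rt (le_trans s0).
  have h0 : 0 <= h by near: h; exact: nbhs_right_ge.
  rewrite (linear_funZ Rch) (linear_funB Rch) -scalerDr; congr (_ *: _).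
  rewrite subrKA /phi -jS// /y -SVD ?subr_ge0//.
  by rewrite addrA (addrC h).
- move=> c /andP[sc ct].
  apply: (le_trans (RC _ _ _)); first by rewrite sc ltW.
  rewrite -mulrA ler_wpM2l// distrC (le_trans (Af _ _ _))//; first by rewrite sc ltW.
  rewrite mulrC ler_wpM2r ?f0 ?sc ?(ltW ct)//; apply: SK.
  by rewrite subr_ge0 sc lerB// ltW.
Unshelve. all: by end_near. Qed.

(** * Primitives, averages and continuity of the integrand *)

Lemma continuous_Rintegral_derive (R : realType) (g : R -> R) : continuous g ->
  exists H : R -> R, (forall x : R, 0 <= x -> is_derive x 1 H (g x)) /\
  (forall x : R, 0 <= x -> H x - H 0 = \int[lebesgue_measure]_(t in `[0, x]) g t).
Proof.
move=> cg.
have ig a b : lebesgue_measure.-integrable `[a, b] (EFin \o g).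
  apply: continuous_compact_integrable; first exact: segment_compact.
  exact: continuous_subspaceT.
(* Starting at -1 puts 0 in the interior, so the derivative there is two-sided. *)
exists (fun x => \int[lebesgue_measure]_(t in `[-1, x]) g t); split => x x0.
  have x1 : x < x + 1 by rewrite ltrDl.
  have N1x : -1 < x by rewrite (lt_le_trans _ x0)// ltrN10.
  have [dH <-] := continuous_FTC1_closed x1 (ig (-1) (x + 1)) N1x (cg x).
  by rewrite derive1E; exact: derivableP.
rewrite (Rintegral_itvB (ig (-1) x)) ?bnd_simp ?lerN10//.
rewrite Rintegral_itv_obnd_cbnd//.
by apply: integrableS (ig 0 x) => //; apply: subset_itvr; rewrite bnd_simp.
Qed.

Lemma Rintegral_average_le (R : realType) (g : R -> R) (T1 e : R) :
  continuous g -> (forall x, 0 <= g x) -> 0 < T1 ->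
  (forall T, T1 <= T ->
    (T^-1%:E * \int[lebesgue_measure]_(t in `[0%R, T]%classic) (g t)%:E <= e%:E)%E) ->
  forall T, 0 <= T -> \int[lebesgue_measure]_(t in `[0, T]) g t <= e * (T + T1).
Proof.
move=> cg g0 T10 gT T T0.
have ig a b : lebesgue_measure.-integrable `[a, b] (EFin \o g).
  apply: continuous_compact_integrable; first exact: segment_compact.
  exact: continuous_subspaceT.
have TT1 : 0 < T + T1 by rewrite ltr_wpDl.
rewrite -lee_fin /Rintegral fineK; last exact: integrable_fin_num.
have := gT (T + T1); rewrite lerDr => /(_ T0).
rewrite lee_pdivrMl// -EFinM mulrC; apply: le_trans.
apply: ge0_subset_integral => //.
- have /integrableP[] := ig 0 (T + T1); exact.
- by move=> x _; rewrite lee_fin.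
- by apply: subset_itvl; rewrite bnd_simp lerDl ltW.
Qed.

(** Clipping time at 0 extends the integrand to the whole line, as needed for a primitive of a
    continuous function; clipping is 1-Lipschitz, so the modulus [d] survives. *)
Lemma opnorm_sub_continuous (R : realType) (V E : normedModType R)
    (B : R -> V -> E) (L : V -> E) :
  (forall t, 0 <= t -> linear (B t)) -> linear L ->
  (forall t, 0 <= t -> opnorm (fun v => B t v - L v) \is a fin_num) ->
  (forall t0, 0 <= t0 -> forall e : R, 0 < e -> exists2 d : R, 0 < d &
     forall t, 0 <= t -> `|t - t0| < d ->
       (opnorm (fun v => (B t v - B t0 v)%R) <= e%:E)%E) ->
  continuous (fun t : R => fine (opnorm (fun v => B (Num.max t 0) v - L v))).
Proof.
move=> lB lL fB cB t0; apply/cvgrPdist_le => e e0.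
have m0 (t : R) : 0 <= Num.max t 0 by rewrite le_max lexx orbT.
have [d d0 dP] := cB _ (m0 t0) _ e0.
near=> t; rewrite distrC; apply: fine_opnorm_dist; rewrite ?fB//.
- by apply: linear_subfun => //; exact: lB.
- by apply: linear_subfun => //; exact: lB.
have -> : (fun v => B (Num.max t 0) v - L v - (B (Num.max t0 0) v - L v)) =
    (fun v => B (Num.max t 0) v - B (Num.max t0 0) v).
  by apply/funext => v; rewrite opprB addrA subrK.
apply: dP => //; apply: (@le_lt_trans _ _ `|t0 - t|).
  rewrite /Num.max; case: ifPn; case: ifPn; rewrite -?leNgt => h1 h2.
  - by rewrite subrr normr0.
  - by rewrite sub0r normrN !ger0_norm; lra.
  - by rewrite subr0 distrC; rewrite !ger0_norm; lra.
  - by rewrite distrC.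
by near: t; exact: cvgr_dist_lt.
Unshelve. all: by end_near. Qed.

Theorem theorem3p3 (R : realType) (E V : completeNormedModType R)
  (j : V -> E) (P : metricType R)
  (Adom : P -> R -> set E) (A : P -> R -> E -> E)
  (S : P -> R -> R -> E -> E) (SV : P -> R -> R -> V -> V)
  (AVdom : P -> R -> set V) (AV : P -> R -> V -> V)
  (M MV w wV : R)
  (Rev : P -> R -> R -> R -> E -> E)
  (Ahdom : P -> set E) (Ah : P -> E -> E) (Sh : P -> R -> E -> E)
  (SVh : P -> R -> V -> V) :
  (* V densely and continuously embedded in E *)
  linear j -> continuous j -> injective j -> closure (range j) = setT ->
  1 <= M -> 1 <= MV ->
  (* (Hyp1) *)
  (forall mu t, 0 <= t -> generates (Adom mu t) (A mu t) (S mu t)) ->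
  (forall mu, stable (S mu) M w) ->
  (* (Hyp2) *)
  (forall mu t, 0 <= t -> admissible j (S mu t) (SV mu t)) ->
  (forall mu t, 0 <= t -> part_in j (Adom mu t) (A mu t) (AVdom mu t) (AV mu t)) ->
  (forall mu t, 0 <= t -> generates (AVdom mu t) (AV mu t) (SV mu t)) ->
  (forall mu, stable (SV mu) MV wV) ->
  (* (Hyp3) *)
  (forall mu t v, 0 <= t -> Adom mu t (j v)) ->
  (forall mu t, 0 <= t -> continuous (fun v => A mu t (j v))) ->
  (forall mu t0, 0 <= t0 -> forall e : R, 0 < e -> exists2 d : R, 0 < d &
     forall t, 0 <= t -> `|t - t0| < d ->
       (opnorm (fun v => (A mu t (j v) - A mu t0 (j v))%R) <= e%:E)%E) ->
  (* R^(mu,lambda) is the evolution system corresponding to A^(mu)(./lambda) *)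
  (forall mu lam, 0 < lam ->
     corresponding_evol j (fun t => A mu (t / lam)) M w (Rev mu lam)) ->
  (* the limit operators \hat A^(mu) *)
  (forall mu, generates (Ahdom mu) (Ah mu) (Sh mu)) ->
  (forall mu, admissible j (Sh mu) (SVh mu)) ->
  (forall mu v, Ahdom mu (j v)) ->
  (forall (mu : P) (e : R), 0 < e -> exists T0 : R, exists2 U, nbhs mu U &
     forall T nu h, T0 <= T -> 0 < T -> U nu -> 0 <= h ->
       ((T^-1)%:E * \int[lebesgue_measure]_(t in `[0%R, T]%classic)
          opnorm (fun v => (A nu (t + h)%R (j v) - Ah mu (j v))%R) <= e%:E)%E) ->
  (forall mu lam t s x, 0 < lam -> 0 <= s <= t ->
     `|Rev mu lam t s x| <= M * expR (w * (t - s)) * `|x|) /\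
  (forall mu (u : E) (Tb e : R), 0 < e -> exists2 d : R, 0 < d &
     exists2 U, nbhs mu U &
     forall lam v nu t s, 0 < lam -> lam < d -> `|v - u| < d -> U nu ->
       0 <= s -> s <= t -> t <= Tb ->
       `|Rev nu lam t s v - Sh mu (t - s) u| < e).
Proof.

move=> linj contj _ densej M1 _ genA _ _ _ _ _ domA contA contA' evolR genAh admAh
  domAh avg.
have evolR' mu lam t s x : 0 < lam -> 0 <= s <= t ->
    `|Rev mu lam t s x| <= M * expR (w * (t - s)) * `|x|.
  by move=> lam0 st; have [_ + _ _] := evolR mu lam lam0; exact.
split=> // mu u Tb e e0.
have linAj nu t : 0 <= t -> linear (fun v => A nu t (j v)).
  by move=> t0; apply: (generator_linear (genA nu t t0) linj) => v; exact: domA.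
have linAhj : linear (fun v => Ah mu (j v)).
  exact: (generator_linear (genAh mu) linj).
(* The averaging hypothesis bounds [Ah mu] on V without the closed graph theorem:
   otherwise every difference [A mu t - Ah mu] would have infinite norm. *)
have [k k0 kP] : exists2 k : R, 0 <= k & forall v, `|Ah mu (j v)| <= k * `|v|.
  have [T0 [U /nbhs_singleton Umu avgU]] := avg mu 1 ltr01.
  have [t [t0 tfin]] : exists t, 0 <= t /\
      opnorm (fun v => A mu t (j v) - Ah mu (j v)) \is a fin_num.
    apply: contrapT => ninf.
    pose T := Num.max T0 1.
    have T10 : 0 < T by rewrite lt_max ltr01 orbT.
    have := avgU T mu 0; rewrite le_max lexx T10 => /(_ isT isT Umu (lexx _)).
    rewrite (_ : integral _ _ _ = +oo)%E ?gt0_muley ?lte_fin ?invr_gt0//.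
    rewrite (eq_integral (fun=> +oo%E)).
      rewrite integral_cst//= lebesgue_measure_itv/= lte_fin T10 oppr0 adde0.
      by rewrite gt0_mulye ?lte_fin.
    move=> t; rewrite inE/= in_itv/= => /andP[t0 _]; apply/eqP; rewrite -leye_eq leNgt.
    apply/negP => toy; apply: ninf; exists t; split=> //.
    by rewrite ge0_fin_numE ?opnorm_ge0//; move: toy; rewrite addr0.
  have [k1 k10 k1P] := linear_continuous_norm_le (linAj mu t t0) (contA mu t t0).
  exists (k1 + fine (opnorm (fun v => A mu t (j v) - Ah mu (j v)))).
    by rewrite addr_ge0// fine_ge0// opnorm_ge0.
  move=> v; rewrite -[Ah mu (j v)](subrK (A mu t (j v))) addrC mulrDl.
  rewrite (le_trans (ler_normD _ _))// lerD// distrC.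
  apply: (le_opnorm (linear_subfun (linAj mu t t0) linAhj)).
  by rewrite fineK.
have finB nu t : 0 <= t -> opnorm (fun v => A nu t (j v) - Ah mu (j v)) \is a fin_num.
  move=> t0; have [k1 k10 k1P] := linear_continuous_norm_le (linAj nu t t0) (contA nu t t0).
  apply: (@opnorm_fin_num _ _ _ _ (k1 + k)); last by rewrite addr_ge0.
  by move=> v; rewrite (le_trans (ler_normB _ _))// mulrDl lerD.
have [C0Sh _ _] := genAh mu.
have [jSV C0SVh] := admAh mu.
(* [Bd] is nonnegative whatever the sign of [Tb]; likewise [|w|] in [C] below gives a bound over
   [[0, Bd]] whatever the sign of [w]. *)
pose Bd := `|Tb|.
have Bd0 : 0 <= Bd by exact: normr_ge0.
have [K1 K10 K1P] := C0_semigroup_locally_bounded C0Sh Bd.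
have [K2 K20 K2P] := C0_semigroup_locally_bounded C0SVh Bd.
pose C := M * expR (`|w| * Bd).
have C0 : 0 < C by rewrite mulr_gt0 ?expR_gt0// (lt_le_trans ltr01).
have RC nu lam t s x : 0 < lam -> 0 <= s -> s <= t -> t <= Tb ->
    `|Rev nu lam t s x| <= C * `|x|.
  move=> lam0 s0 st tT; rewrite (le_trans (evolR' _ _ _ _ _ lam0 _)) ?s0//.
  rewrite ler_wpM2r// ler_wpM2l ?(le_trans ler01)// ler_expR.
  rewrite (@le_trans _ _ (`|w| * (t - s)))//.
    by rewrite ler_wpM2r ?subr_ge0// ler_norm.
  by rewrite ler_wpM2l// (le_trans _ (ler_norm Tb))// lerBlDr (le_trans tT)// lerDl.
(* Replacing [u] by [j v0] costs [C * eta] on the evolution side and [K1 * eta] on the semigroup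
   side, [e / 4] in total. *)
pose eta := e / (4 * (C + K1)).
have eta0 : 0 < eta by rewrite divr_gt0// mulr_gt0// addr_gt0.
have [v0 v0P] : exists v0, `|u - j v0| < eta.
  have : closure (range j) u by rewrite densej.
  move=> /(_ (ball u eta) (nbhsx_ballx _ _ eta0))[_ [[v0 _ <-]]].
  by rewrite -ball_normE /= => ?; exists v0.
pose K := K2 * `|v0|.
have K0 : 0 <= K by rewrite mulr_ge0// ltW.
(* The factor [Bd + 1] bounds [(t - s) + lam * T1]. The [+ 1] in [e1] allows [D = 0], and
   [D * e1 <= e / 4]. *)
pose D := C * K * (Bd + 1).
have D0 : 0 <= D by rewrite mulr_ge0 ?addr_ge0// mulr_ge0// ltW.
pose e1 := e / (4 * (D + 1)).
have e10 : 0 < e1 by rewrite divr_gt0// mulr_gt0// ltr_wpDl.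
have [T0 [U muU avgU]] := avg mu e1 e10.
pose T1 := Num.max T0 1.
have T10 : 0 < T1 by rewrite lt_max ltr01 orbT.
(* The first bound gives [C * |v - u| < e / 4], the second [lam * T1 < 1]. *)
exists (Num.min (e / (4 * C)) T1^-1).
  by rewrite lt_min invr_gt0 T10 divr_gt0// mulr_gt0.
exists U => // lam v nu t s lam0 + + Unu s0 st tT; rewrite !lt_min => /andP[_ lamT] /andP[vu _].
have [[linR _ _ _] _ _ _] := evolR nu lam lam0.
have linRts : linear (Rev nu lam t s) by have [] := linR t s; rewrite // s0.
have linSh : linear (Sh mu (t - s)).
  by have [linS _ _ _] := C0Sh; have [] := linS (t - s); rewrite // subr_ge0.
have tsB : 0 <= t - s <= Bd.
  by rewrite subr_ge0 st lerBlDr (le_trans tT)// (le_trans (ler_norm _))// lerDl.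
pose G r := fine (opnorm (fun v => A nu (Num.max r 0) (j v) - Ah mu (j v))).
have cG : continuous G.
  apply: (@opnorm_sub_continuous _ _ _ (fun r v => A nu r (j v)) (fun v => Ah mu (j v))) => //.
  - exact: linAj.
  - exact: finB.
  - exact: contA'.
have G0 r : 0 <= G r by rewrite fine_ge0// opnorm_ge0.
(* The averages are uniform in the shift [h]; taking [h = s / lam] moves the fast-time interval to
   [[0, (t - s) / lam]]. *)
pose g r := G (r + s / lam).
have cg : continuous g.
  move=> r; apply: (@continuous_comp _ _ _ (fun r => r + s / lam) G); last exact: cG.
  by apply: cvgD; [exact: cvg_id|exact: cvg_cst].
have sl0 : 0 <= s / lam by rewrite divr_ge0// ltW.
have [H [dH HE]] := continuous_Rintegral_derive cg.
have ts0 : 0 <= (t - s) / lam by rewrite divr_ge0 ?subr_ge0// ltW.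
have HB : lam * (H ((t - s) / lam) - H 0) <= e1 * (Bd + 1).
  rewrite HE//.
  have gavg T : T1 <= T ->
      (T^-1%:E * \int[lebesgue_measure]_(r in `[0%R, T]%classic) (g r)%:E <= e1%:E)%E.
    move=> TT1; have T_gt0 : 0 < T by exact: lt_le_trans TT1.
    have T0T : T0 <= T by rewrite (le_trans _ TT1)// le_max lexx.
    apply: le_trans (avgU T nu (s / lam) T0T T_gt0 Unu sl0).
    apply: lee_wpmul2l; first by rewrite lee_fin invr_ge0 ltW.
    rewrite le_eqVlt; apply/orP; left; apply/eqP; apply: eq_integral => r.
    rewrite inE/= in_itv/= => /andP[r0 _].
    by rewrite /g /G max_l ?fineK ?finB// addr_ge0.
  have Hle := Rintegral_average_le cg (fun r => G0 _) T10 gavg ts0.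
  apply: (@le_trans _ _ (lam * (e1 * ((t - s) / lam + T1)))).
    by rewrite ler_pM2l.
  rewrite mulrCA ler_pM2l// mulrDr mulrCA divff ?gt_eqF// mulr1.
  have /andP[_ tsB'] := tsB.
  by rewrite lerD// -ler_pdivlMr// div1r ltW.
have mid : `|Rev nu lam t s (j v0) - Sh mu (t - s) (j v0)| <= D * e1.
  rewrite distrC.
  (* Change to fast time: the factors [lam] and [lam^-1] cancel in the chain rule, and the shift in
     [g] restores [r / lam]. *)
  have dF r : s <= r <= t -> is_derive r 1 (fun r => lam * H ((r - s) / lam)) (G (r / lam)).
    move=> /andP[sr rt].
    have rs0 : 0 <= (r - s) / lam by rewrite divr_ge0 ?subr_ge0// ltW.
    have dH' := dH _ rs0.
    have drs : is_derive r 1 (fun r : R => (r - s) / lam) lam^-1.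
      by apply: is_derive_eq; rewrite !scaler0 subr0 add0r /GRing.scale/= mulr1.
    have := is_deriveZ lam (@is_derive1_comp _ H (fun r : R => (r - s) / lam) r _ _ dH' drs).
    rewrite /GRing.scale/= /g mulrCA divff ?gt_eqF// mulr1 -mulrDl subrK.
    exact.
  have := @evol_semigroup_dist _ _ _ j _ _ _ _ _ _ _ _ _ _ C K s t v0 linj contj
    (evolR nu lam lam0) (genAh mu) (admAh mu) (domAh mu)
    (C0_semigroup_continuous (x := v0) C0SVh) _ (ltW C0) _ _ dF.
  rewrite s0 st => /(_ isT) Hd; apply: (le_trans (Hd _ _ _ _)).
  - by move=> r x /andP[sr rt]; apply: RC => //; exact: le_trans sr.
  - by move=> r /andP[r0 rt]; apply: K2P; rewrite r0 (le_trans rt)//; have /andP[] := tsB.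
  - by move=> r _; exact: G0.
  - move=> r z /andP[sr rt].
    have rl0 : 0 <= r / lam by rewrite divr_ge0 ?(ltW lam0)// (le_trans s0).
    apply: (le_opnorm (linear_subfun (linAj nu _ rl0) linAhj)).
    by rewrite /G max_l// fineK// finB.
  rewrite -mulrBr subrr mul0r /D -[leRHS]mulrA (mulrC _ e1).
  by rewrite ler_wpM2l// mulr_ge0// ltW.
have part1 : `|Rev nu lam t s v - Rev nu lam t s (j v0)| <= C * (`|v - u| + `|u - j v0|).
  rewrite -(linear_funB linRts) (le_trans (RC _ _ _ _ _ lam0 s0 st tT))// ler_pM2l//.
  by rewrite -[v - j v0](subrKA u) ler_normD.
have part3 : `|Sh mu (t - s) (j v0) - Sh mu (t - s) u| <= K1 * `|u - j v0|.
  by rewrite -(linear_funB linSh) (le_trans (K1P _ _ tsB))// distrC.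
have m1 : C * `|v - u| < e / 4.
  by rewrite mulrC -ltr_pdivlMr// -mulrA -invfM.
have m2 : (C + K1) * `|u - j v0| < e / 4.
  by rewrite mulrC -ltr_pdivlMr ?addr_gt0// -mulrA -invfM.
have m3 : D * e1 <= e / 4.
  have -> : D * e1 = e / 4 * (D / (D + 1)) by rewrite /e1 invfM; ring.
  rewrite ler_piMr ?divr_ge0 ?(ltW e0)//.
  by rewrite ler_pdivrMr ?ltr_wpDl// mul1r lerDl.
(* The three errors, from [v] to [u], from [u] to [j v0] and from averaging, add up to less than
   [3 * e / 4]. *)
have := ler_distD (Rev nu lam t s (j v0)) (Rev nu lam t s v) (Sh mu (t - s) u).
have := ler_distD (Sh mu (t - s) (j v0)) (Rev nu lam t s (j v0)) (Sh mu (t - s) u).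
rewrite mulrDr in part1; rewrite mulrDl in m2.
lra.
Qed.
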